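(* Let $f_1,\dots,f_m$ be analytic functions of $m$ real variables and let $\vec x^*=(x_1^*,\dots,x_m^* )$ be an equilibrium of the target system $dx_i/dt=f_i(\vec x)$, $i=1,\dots,m$. Consider the extended system for $\vec X_1,\dots,\vec X_m\in\mathbb{R}^N$ $$\frac{d\vec X_i}{dt}=\boldsymbol{\Omega}_1\boldsymbol{F}^{(mc)}_i(\vec X_1,\dots,\vec X_m)\vec 1+\boldsymbol{Q}_i(\boldsymbol{\Omega}_1)\vec X_i,\qquad i=1,\dots,m,$$ built on the mixed commutative map $\boldsymbol{F}^{(mc)}_i$, where the decay functions $\boldsymbol{Q}_i(\boldsymbol{\Omega}_1)\vec X_i$ ($\boldsymbol{Q}_i(\boldsymbol{\Omega}_1)$ an $N\times N$ matrix) are assumed to be $\boldsymbol{\Omega}_1$-eligible. Then, for any ordering $S$, the Jacobian matrix evaluated at the equilibrium $\vec X_i^*=x_i^*\vec 1$, $i=1,\dots,m$, is given by the $N\times N$ blocks ($i,j=1,\dots,m$; block $(i,j)$ is the derivative of the $i$-th vector equation with respect to $\vec X_j$) $$\boldsymbol{J}^{(mc)}_{ij}(\{\vec X_i^*\})=\boldsymbol{\Omega}_1\,\frac{\partial f_i}{\partial x_j}(\vec x^* )+\delta_{ij}\boldsymbol{Q}_i(\boldsymbol{\Omega}_1).$$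
   Context: $\vec 1\in\mathbb{R}^N$ is the all-ones vector, $\boldsymbol{I}$ the $N\times N$ identity, $\boldsymbol{\Omega}_1$ the $N\times N$ matrix with all entries $1/N$, $\delta_{ij}$ the Kronecker symbol; for $\vec X_i=(X_{i,1},\dots,X_{i,N})$, $\boldsymbol{X}_i=\mathrm{diag}(X_{i,1},\dots,X_{i,N})$. The Taylor expansion of $f_i$ is written $f_i(x_1,\dots,x_m)=\sum_{k\ge0}\sum_{j_1+\dots+j_m=k}a_{i,k;j_1,\dots,j_m}x_1^{j_1}\cdots x_m^{j_m}$, with constant term $a_{i,0}$. Mixed commutative map: $\boldsymbol{F}^{(mc)}_i=a_{i,0}\boldsymbol{I}+\sum_{k\ge1}\sum_{j_1+\dots+j_m=k}a_{i,k;j_1,\dots,j_m}\big(\boldsymbol{\Omega}_1(\boldsymbol{X}_1^{j_1}\cdots\boldsymbol{X}_m^{j_m})^{1/k}\big)^k$, powers of diagonal matrices being taken entrywise on the diagonal. An ordering $S$ is a rule for arranging the factors of products of the non-commuting matrices $\boldsymbol{\Omega}_1\boldsymbol{X}_i$; since the diagonal matrices $\boldsymbol{X}_i$ commute, it is immaterial for this map. A decay function $\vec G_i(\boldsymbol{\Omega}_1;\vec X_i)$ is $\boldsymbol{\Omega}_1$-eligible if $\lim_{t\to+\infty}\boldsymbol{\Omega}_1\vec G_i(\boldsymbol{\Omega}_1;\vec X_i(t))=\vec 0$ and if the solution of the system $\frac{d\vec X_{ci}}{dt}=(\boldsymbol{I}-\boldsymbol{\Omega}_1)\vec G_i(\boldsymbol{\Omega}_1;\vec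 X_i)$ obtained by projecting the extended system, with $\vec X_{ci}=(\boldsymbol{I}-\boldsymbol{\Omega}_1)\vec X_i$, satisfies $\lim_{t\to\infty}\vec X_{ci}(t)=\vec 0$.
   Formalization: If x* has a zero coordinate the formula can fail (f_1=x_1x_2, f_2=0, x*=(0,1), N>1: derivative 1/N^2, not 1/N). It is proved where the field is differentiable at X*; this is shown if no nonlinear monomial of f_i has degree exactly 1 in the variables vanishing at x*. *)

(* Defs.v *)
From HB Require Import structures.
From mathcomp Require Import all_boot all_order all_algebra.
From mathcomp Require Import all_classical all_reals all_analysis.
From mathcomp Require Import complex.

Set Implicit Arguments.
Unset Strict Implicit.
Unset Printing Implicit Defensive.

Import Order.TTheory GRing.Theory Num.Theory numFieldNormedType.Exports.

Local Open Scope classical_set_scope.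
Local Open Scope ring_scope.

(* MathComp-Analysis puts no topology on R[i]; limits and derivatives of
   R[i]-valued functions of real arguments are taken on Re and Im. *)
Section complex_valued.
Variables (R : realType) (V : normedModType R).

Definition Ccvgn (u : nat -> R[i]) : Prop :=
  cvgn (fun k => complex.Re (u k)) /\ cvgn (fun k => complex.Im (u k)).

Definition Climn (u : nat -> R[i]) : R[i] :=
  Complex (limn (fun k => complex.Re (u k))) (limn (fun k => complex.Im (u k))).

Definition Cdifferentiable (g : V -> R[i]) (p : V) : Prop :=
  differentiable (fun v => complex.Re (g v)) p /\
  differentiable (fun v => complex.Im (g v)) p.

Definition Cderive (g : V -> R[i]) (p v : V) : R[i] :=
  Complex ('D_v (fun w => complex.Re (g w)) p)
          ('D_v (fun w => complex.Im (g w)) p).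

End complex_valued.

Definition Omega1 (F : numFieldType) (N : nat) : 'M[F]_N := const_mx N%:R^-1.
Arguments Omega1 : clear implicits.

Definition embed (R : realType) (p q : nat) (A : 'M[R]_(p, q)) : 'M[R[i]]_(p, q) :=
  map_mx (real_complex R) A.

Section taylor.
Variables (R : realType) (m : nat).

Definition mdeg (J : 'I_m -> nat) : nat := (\sum_(l < m) J l)%N.

(* The multi-indices of degree k all take values in {0,...,k}, so that they
   can be enumerated inside {ffun 'I_m -> 'I_k.+1}. *)
Definition mexp (k : nat) (J : {ffun 'I_m -> 'I_k.+1}) : 'I_m -> nat :=
  fun l => J l : nat.

Definition monomial (J : 'I_m -> nat) (x : 'rV[R]_m) : R :=
  \prod_(l < m) x 0 l ^+ J l.

(* The power series with coefficients a converges absolutely to g on the open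
   polydisc of polyradius r centred at 0. *)
Definition taylor_expansion (r : 'I_m -> R) (g : 'rV[R]_m -> R)
    (a : ('I_m -> nat) -> R) : Prop :=
  forall x : 'rV[R]_m, (forall l, `|x 0 l| < r l) ->
    cvgn (series (fun k =>
      \sum_(J : {ffun 'I_m -> 'I_k.+1} | mdeg (mexp J) == k)
        `|a (mexp J) * monomial (mexp J) x|)) /\
    series (fun k =>
      \sum_(J : {ffun 'I_m -> 'I_k.+1} | mdeg (mexp J) == k)
        a (mexp J) * monomial (mexp J) x) @ \oo --> g x.

(* An ordering arranges the factors of the product with exponents J: it is a
   word in the variables, in which the l-th variable occurs J l times. *)
Record ordering := Ordering {
  arrange :> ('I_m -> nat) -> seq 'I_m;
  arrangeP : forall J l, count_mem l (arrange J) = J l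
}.

End taylor.

Section extended_system.
Variables (R : realType) (m N : nat).

(* The state (X_1, ..., X_m) of the extended system is the m x N real matrix
   whose i-th row is X_i. *)
Definition component (i : 'I_m) (X : 'M[R]_(m, N)) : 'cV[R]_N := (row i X)^T.

Definition diag_component (i : 'I_m) (X : 'M[R]_(m, N)) : 'M[R[i]]_N :=
  diag_mx (embed (row i X)).

(* (X_1^{j_1} ... X_m^{j_m})^{1/k}, with complex k-th roots taken entrywise on
   the diagonal.  For real z, k.-root z is the principal k-th root of z: it
   is the nonnegative real root when z >= 0. *)
Definition diag_root (S : ordering m) (k : nat) (J : 'I_m -> nat)
    (X : 'M[R]_(m, N)) : 'M[R[i]]_N :=
  let D := \prod_(p <- S J) diag_component p X in
  diag_mx (\row_n k.-root (D n n)).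

Definition mc_term (S : ordering m) (a : ('I_m -> nat) -> R) (k : nat)
    (X : 'M[R]_(m, N)) : 'M[R[i]]_N :=
  \sum_(J : {ffun 'I_m -> 'I_k.+1} | mdeg (mexp J) == k)
    real_complex R (a (mexp J)) *:
      (Omega1 R[i] N *m diag_root S k (mexp J) X) ^+ k.

Definition mc_cvg (S : ordering m) (a : ('I_m -> nat) -> R)
    (X : 'M[R]_(m, N)) : Prop :=
  forall n l, Ccvgn (series (fun k => mc_term S a k.+1 X n l)).

Definition mc_map (S : ordering m) (a : ('I_m -> nat) -> R)
    (X : 'M[R]_(m, N)) : 'M[R[i]]_N :=
  (real_complex R (a (fun=> 0%N)))%:M +
  \matrix_(n, l) Climn (series (fun k => mc_term S a k.+1 X n l)).

Definition decay := 'I_m -> 'M[R]_N -> 'cV[R]_N -> 'cV[R]_N.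

Definition linear_decay (Q : 'I_m -> 'M[R]_N -> 'M[R]_N) : decay :=
  fun i Om x => Q i Om *m x.

Definition ext_field (S : ordering m) (a : 'I_m -> ('I_m -> nat) -> R)
    (G : decay) (i : 'I_m) (X : 'M[R]_(m, N)) : 'cV[R[i]]_N :=
  Omega1 R[i] N *m mc_map S (a i) X *m const_mx 1 +
  embed (G i (Omega1 R N) (component i X)).

(* A solution is a real trajectory; in particular the right-hand side has to
   be real along it. *)
Definition ext_solution (S : ordering m) (a : 'I_m -> ('I_m -> nat) -> R)
    (G : decay) (X : R -> 'M[R]_(m, N)) : Prop :=
  forall t : R, 0 < t -> derivable X t 1 /\
    forall i, mc_cvg S (a i) (X t) /\
      embed (component i ('D_1 X t)) = ext_field S a G i (X t).

(* Omega1-eligibility of the i-th decay function.  Since (I - Omega1) Omega1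
   = 0, projecting the extended system gives the equation for Xc below. *)
Definition eligible (S : ordering m) (a : 'I_m -> ('I_m -> nat) -> R)
    (G : decay) (i : 'I_m) : Prop :=
  forall X, ext_solution S a G X ->
    let Gi := fun t => G i (Omega1 R N) (component i (X t)) in
    let Xc := fun t => (1%:M - Omega1 R N) *m component i (X t) in
    (fun t => Omega1 R N *m Gi t) @ +oo --> (0 : 'cV[R]_N) /\
    ((forall t : R, 0 < t -> is_derive t 1 Xc ((1%:M - Omega1 R N) *m Gi t)) ->
      Xc @ +oo --> (0 : 'cV[R]_N)).

Definition lift_state (x : 'rV[R]_m) : 'M[R]_(m, N) := \matrix_(i, n) x 0 i.

Definition ext_differentiable (S : ordering m)
    (a : 'I_m -> ('I_m -> nat) -> R) (G : decay) (i : 'I_m)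
    (X : 'M[R]_(m, N)) : Prop :=
  forall n, Cdifferentiable (fun Y => ext_field S a G i Y n 0) X.

Definition jacobian_block (S : ordering m)
    (a : 'I_m -> ('I_m -> nat) -> R) (G : decay) (X : 'M[R]_(m, N))
    (i j : 'I_m) : 'M[R[i]]_N :=
  \matrix_(n, l) Cderive (fun Y => ext_field S a G i Y n 0) X (delta_mx j l).

End extended_system.

(* No nonlinear monomial is of degree exactly 1 in the coordinates that vanish
   at x; this holds in particular if no coordinate of x vanishes, or if all do.
   A monomial of degree 1 there really is an obstruction: for N > 1 the term
   of x_1 x_2, built on ((1/N) \sum_n (X_{1,n} X_{2,n})^{1/2})^2, is not
   differentiable at x_1 = 0, x_2 = 1. *)
Definition mc_regular (R : realType) (m : nat) (a : ('I_m -> nat) -> R)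
    (x : 'rV[R]_m) : Prop :=
  forall J, a J != 0 -> (1 < mdeg J)%N ->
    (\sum_(l < m | (x 0 l == 0)%R) J l != 1)%N.

(* Main.v *)
(* The i-th equation of the extended system is governed by the scalar series
   g(X) = a_0 + \sum_J a_J (mean_n (X_n^J)^{1/|J|})^|J|, because Omega1 times a
   diagonal matrix has rank one.  On synchronised states g restricts to f, and
   g is invariant under permutations of the N copies: where it is
   differentiable, its derivatives with respect to the copies X_{j,1}, ...,
   X_{j,N} coincide and add up to df/dx_j, so each of them is (1/N) df/dx_j.

   For the differentiability let xbar_l be the mean of X_l and t the scaled
   distance of X to the equilibrium.  If x_l <> 0 for all l occurring in J,
   then AM-GM, used twice, traps |J-th term| between y^J and |xbar|^J, where
   |xbar| - y = O(t^2); if two or more factors (counted with multiplicity)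
   vanish at the equilibrium, then both the J-th term and xbar^J are O(t^2).
   The constants are dominated by the coefficients of the absolutely convergent
   Taylor series on a slightly larger polydisc, so g(X) = f(xbar) + O(t^2). *)
Require Import Defs.
From HB Require Import structures.
From mathcomp Require Import all_boot all_order all_algebra.
From mathcomp Require Import all_classical all_reals all_analysis.
From mathcomp Require Import complex.
From mathcomp Require Import perm ring lra.

Set Implicit Arguments.
Unset Strict Implicit.
Unset Printing Implicit Defensive.

Import Order.TTheory GRing.Theory Num.Theory numFieldNormedType.Exports.

Local Open Scope classical_set_scope.
Local Open Scope ring_scope.

(** * Products over words and power means *)

Section words.
Variables (R : realFieldType) (I : eqType).
Implicit Types (s : seq I) (x y z h w : I -> R).

Lemma prod_seq_le_AGM w s : {in s, forall p, 0 <= w p} ->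
  \prod_(p <- s) w p <= ((\sum_(p <- s) w p) / (size s)%:R) ^+ size s.
Proof.
move=> w0; rewrite !(big_tnth _ _ s).
have := @leif_AGM R 'I_(size s) predT (fun i => w (tnth (in_tuple s) i))
  (fun i _ => w0 _ (mem_tnth i (in_tuple s))).
by rewrite cardT size_enum_ord => -[].
Qed.

(** Telescoping along the word: exchanging one letter costs at most [t * e] times the product of the
    others, and enlarging every factor by [e] on the right leaves exactly the room for this cost. *)
Lemma prod_seq_perturb x y (e t : R) s : 0 <= e -> 0 <= t ->
  (forall p, p \in s -> [/\ 0 <= y p, y p <= x p & x p - y p <= t * e]) ->
  \prod_(p <- s) x p - \prod_(p <- s) y p <= t * \prod_(p <- s) (x p + e).
Proof.
move=> e0 t0; elim: s => [_|p s IH H]; first by rewrite !big_nil subrr mulr1.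
rewrite !big_cons.
have [yp yx xy] := H p (mem_head _ _).
have Hs q : q \in s -> [/\ 0 <= y q, y q <= x q & x q - y q <= t * e].
  by move=> qs; apply: H; rewrite inE qs orbT.
have xp : 0 <= x p by exact: le_trans yx.
have Y : \prod_(q <- s) y q <= \prod_(q <- s) (x q + e).
  rewrite [leLHS]big_seq [leRHS]big_seq; apply: ler_prod => q /Hs[y0 ? _].
  by rewrite y0; lra.
have := IH Hs.
set X := \prod_(q <- s) x q; set Y' := \prod_(q <- s) y q in Y *.
set Z := \prod_(q <- s) (x q + e) in Y * => IH'.
have Y0 : 0 <= Y'.
  by rewrite /Y' big_seq; apply: prodr_ge0 => q /Hs[].
have -> : x p * X - y p * Y' = x p * (X - Y') + (x p - y p) * Y' by ring.
have h1 := ler_wpM2l xp IH'.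
have h2 := ler_wpM2r Y0 xy.
have h3 := ler_wpM2l (mulr_ge0 t0 e0) Y.
by rewrite [leRHS](_ : _ = x p * (t * Z) + t * e * Z); [lra | ring].
Qed.

(** Partial derivative with respect to the variable [l] of the monomial spelled by [s], computed by
    the product rule along the word. *)
Fixpoint dprod x s (l : I) : R :=
  if s is p :: s' then (p == l)%:R * (\prod_(q <- s') x q) + x p * dprod x s' l
  else 0.

Lemma prod_seq_le_shift x (e : R) s : 0 <= e ->
  `|\prod_(p <- s) x p| <= \prod_(p <- s) (`|x p| + e).
Proof.
by move=> e0; rewrite normr_prod; apply: ler_prod => p _; rewrite normr_ge0 lerDl.
Qed.

(** A Cauchy-type estimate: the expanded right-hand side has only nonnegative terms, and those of
    first order in [e] already dominate the left-hand side. *)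
Lemma dprod_le x (e : R) s l : 0 <= e ->
  `|dprod x s l| * e <= \prod_(p <- s) (`|x p| + e).
Proof.
move=> e0; elim: s => [|p s IH] /=; first by rewrite normr0 mul0r big_nil.
rewrite big_cons; have P := prod_seq_le_shift x s e0.
set M := \prod_(q <- s) (_ + e) in IH P *.
have h1 := ler_wpM2l (normr_ge0 (x p)) IH.
apply: (@le_trans _ _ (`|\prod_(q <- s) x q| * e + `|x p| * (`|dprod x s l| * e))).
  rewrite mulrA -mulrDl ler_wpM2r// (le_trans (ler_normD _ _))// !normrM lerD2r.
  by rewrite ler_piMl// ger0_norm ?ler0n// lern1 leq_b1.
have h2 := ler_wpM2r e0 P.
lra.
Qed.

(* The norm a + b + c of the expansion A + t B + t^2 C with |A| <= a, |B| <= b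
   and |C| <= c is submultiplicative for 0 <= t <= 1. *)
Lemma prod_seq_taylor1 (E : seq I) x h (e t : R) s : uniq E -> {subset s <= E} ->
  0 <= e -> 0 <= t -> t <= 1 -> (forall p, `|h p| <= t * e) ->
  `|\prod_(p <- s) (x p + h p) - \prod_(p <- s) x p -
    \sum_(l <- E) dprod x s l * h l|
  <= t ^+ 2 * \prod_(p <- s) (`|x p| + e).
Proof.
move=> uE sE e0 t0 t1 hE.
suff [a [b [c [[a0 b0 c0] Ha Hb Hc Habc]]]] : exists a b c : R,
    [/\ [/\ 0 <= a, 0 <= b & 0 <= c],
     `|\prod_(p <- s) x p| <= a,
     `|\sum_(l <- E) dprod x s l * h l| <= t * b,
     `|\prod_(p <- s) (x p + h p) - \prod_(p <- s) x p -
       \sum_(l <- E) dprod x s l * h l| <= t ^+ 2 * c &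
     a + b + c <= \prod_(p <- s) (`|x p| + e)].
  by apply: (le_trans Hc); rewrite ler_wpM2l ?exprn_ge0//; lra.
elim: s sE => [_|p s IH sE] /=.
  exists 1, 0, 0; split; rewrite ?big_nil ?normr1 ?addr0//.
  - by rewrite big1 ?normr0 ?mulr0// => l _; rewrite mul0r.
  - by rewrite subrr sub0r normrN big1 ?normr0 ?mulr0// => l _; rewrite mul0r.
have [|a [b [c [[a0 b0 c0]]]]] := IH.
  by move=> q qs; apply: sE; rewrite inE qs orbT.
set P := \prod_(q <- s) x q; set B := \sum_(l <- E) dprod x s l * h l.
set Ph := \prod_(q <- s) (x q + h q) => Ha Hb Hc Habc.
have pE : p \in E by apply: sE; rewrite mem_head.
have -> : \sum_(l <- E) ((p == l)%:R * P + x p * dprod x s l) * h l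
    = P * h p + x p * B.
  rewrite /B mulr_sumr (bigD1_seq p)//= [in RHS](bigD1_seq p)//= eqxx.
  under eq_bigr => l lp do rewrite eq_sym (negbTE lp) mul0r add0r.
  rewrite mul1r mulrDl addrA mulrA; congr (_ + _).
  by apply: eq_bigr => l _; rewrite mulrA.
rewrite !big_cons -/P -/Ph.
have xp := normr_ge0 (x p).
have te := mulr_ge0 t0 e0.
(* Coefficients of (|x p| + t e)(a + t b + t^2 c), where the term of order t^3 is counted as one of
   order t^2 because t <= 1. *)
exists (`|x p| * a), (`|x p| * b + e * a), (`|x p| * c + e * b + e * c).
split.
- by split; rewrite ?addr_ge0 ?mulr_ge0.
- by rewrite normrM ler_wpM2l.
- rewrite (le_trans (ler_normD _ _))// !normrM.
  have h1 := ler_pM (normr_ge0 P) (normr_ge0 (h p)) Ha (hE p).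
  have h2 := ler_wpM2l xp Hb.
  lra.
- have -> : (x p + h p) * Ph - x p * P - (P * h p + x p * B) =
    x p * (Ph - P - B) + h p * B + h p * (Ph - P - B) by ring.
  have h1 := ler_wpM2l xp Hc.
  have h2 := ler_pM (normr_ge0 (h p)) (normr_ge0 B) (hE p) Hb.
  have h3 := ler_pM (normr_ge0 (h p)) (normr_ge0 (Ph - P - B)) (hE p) Hc.
  have h4 : t * e * (t ^+ 2 * c) <= t ^+ 2 * (e * c).
    rewrite [leLHS](_ : _ = t * (t ^+ 2 * (e * c))); last by ring.
    by rewrite ler_piMl// mulr_ge0 ?exprn_ge0// mulr_ge0.
  rewrite (le_trans (ler_normD _ _))// (le_trans (lerD (ler_normD _ _) (lexx _)))//.
  rewrite !normrM.
  rewrite [leRHS](_ : _ = `|x p| * (t ^+ 2 * c) + t * e * (t * b)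
    + t ^+ 2 * (e * c)); last by ring.
  by apply: lerD; [apply: lerD | apply: le_trans h4].
- have := ler_wpM2l (addr_ge0 xp e0) Habc; lra.
Qed.

End words.

(** * Comparison of means of roots with roots of means *)

Section power_mean.
Variables (R : realFieldType) (I : eqType) (N : nat) (s : seq I).
Variables (u : I -> 'I_N -> R) (d : 'I_N -> R).
Hypotheses (N_gt0 : (0 < N)%N) (s_gt0 : (0 < size s)%N).
Hypothesis u_gt0 : forall n, {in s, forall p, 0 < u p n}.
Hypothesis d_ge0 : forall n, 0 <= d n.
Hypothesis dE : forall n, d n ^+ size s = \prod_(p <- s) u p n.

Let k : R := (size s)%:R.
Let k_gt0 : 0 < k. Proof. by rewrite ltr0n. Qed.

(** AM-GM is applied, for each [n], to the ratios [u p n / z p]; these have mean 1 over [n], so the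
    bounds [Z * q n] average to [Z]. *)
Lemma power_mean_le (z : I -> R) (Z : R) : 0 <= Z ->
  Z ^+ size s = \prod_(p <- s) z p ->
  {in s, forall p, 0 < z p /\ \sum_n u p n = N%:R * z p} ->
  (\sum_n d n) / N%:R <= Z.
Proof.
move=> Z0 ZE zE.
have N0 : 0 < N%:R :> R by rewrite ltr0n.
pose q n := (\sum_(p <- s) u p n / z p) / k.
have w0 n : {in s, forall p, 0 <= u p n / z p}.
  by move=> p ps; rewrite divr_ge0// ltW// ?u_gt0//; have [] := zE _ ps.
have q0 n : 0 <= q n.
  by rewrite divr_ge0 ?(ltW k_gt0)// big_seq sumr_ge0// => p; exact: w0.
have dq n : d n <= Z * q n.
  rewrite -(ler_pXn2r s_gt0) ?nnegrE ?(mulr_ge0 Z0 (q0 n))// exprMn ZE dE.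
  have -> : \prod_(p <- s) u p n =
      \prod_(p <- s) z p * \prod_(p <- s) (u p n / z p).
    rewrite -big_split/= big_seq [RHS]big_seq; apply: eq_bigr => p ps.
    by have [zp _] := zE _ ps; rewrite mulrC mulfVK// gt_eqF.
  rewrite ler_wpM2l ?prod_seq_le_AGM// big_seq prodr_ge0// => p ps.
  by have [/ltW] := zE _ ps.
rewrite ler_pdivrMr//.
apply: (le_trans (ler_sum _ (fun n _ => dq n))).
rewrite -mulr_sumr ler_wpM2l// -mulr_suml ler_pdivrMr// exchange_big/=.
rewrite big_seq (eq_bigr (fun=> N%:R)); last first.
  by move=> p /zE[zp zS]; rewrite -mulr_suml zS mulfK ?gt_eqF.
by rewrite -big_seq big_const_seq count_predT iter_addr_0 mulr_natr.
Qed.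

(** The dual bound: AM-GM is applied to the inverse ratios [y p / u p n], whose mean over [n] is at
    most 1 when [y p] does not exceed the harmonic mean of the [u p n]. *)
Lemma power_mean_ge (y : I -> R) (Z : R) : 0 <= Z ->
  Z ^+ size s = \prod_(p <- s) y p ->
  {in s, forall p, 0 <= y p /\ \sum_n y p / u p n <= N%:R} ->
  Z <= (\sum_n d n) / N%:R.
Proof.
move=> Z0 ZE yE.
have N0 : 0 < N%:R :> R by rewrite ltr0n.
pose q n := (\sum_(p <- s) y p / u p n) / k.
have w0 n : {in s, forall p, 0 <= y p / u p n}.
  by move=> p ps; have [yp _] := yE _ ps; apply: divr_ge0 => //; exact/ltW/u_gt0.
have q0 n : 0 <= q n.
  by rewrite divr_ge0 ?(ltW k_gt0)// big_seq sumr_ge0// => p; exact: w0.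
have dq n : Z <= d n * q n.
  rewrite -(ler_pXn2r s_gt0) ?nnegrE ?(mulr_ge0 (d_ge0 n) (q0 n))// exprMn ZE dE.
  have -> : \prod_(p <- s) y p =
      \prod_(p <- s) u p n * \prod_(p <- s) (y p / u p n).
    rewrite -big_split/= big_seq [RHS]big_seq; apply: eq_bigr => p ps.
    by rewrite mulrC mulfVK// gt_eqF// u_gt0.
  rewrite ler_wpM2l ?prod_seq_le_AGM// big_seq prodr_ge0// => p ps.
  by rewrite ltW// u_gt0.
(* The inequality [q * (2 - q) <= 1] replaces division by [q n] with a bound linear in [q n], which
   can be summed. For [q n > 2] the left-hand side is nonpositive. *)
have dZ n : Z * (2 - q n) <= d n.
  have [q2|q2] := ltP 2 (q n).
    by rewrite (le_trans _ (d_ge0 n))// mulr_ge0_le0//; lra.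
  have q2' : 0 <= 2 - q n by lra.
  apply: (le_trans (ler_wpM2r q2' (dq n))).
  rewrite -mulrA ler_piMr//.
  by rewrite -subr_ge0 (_ : _ - _ = (q n - 1) ^+ 2) ?sqr_ge0//; ring.
rewrite ler_pdivlMr//.
apply: le_trans (ler_sum _ (fun n _ => dZ n)).
rewrite -mulr_sumr ler_wpM2l// sumrB sumr_const card_ord.
suff : \sum_n q n <= N%:R by rewrite -mulr_natr; lra.
rewrite -mulr_suml ler_pdivrMr// exchange_big/=.
rewrite mulr_natr -[size s]count_predT -iter_addr_0 -big_const_seq.
rewrite big_seq [leRHS]big_seq.
by apply: ler_sum => p /yE[].
Qed.

End power_mean.

Lemma inv_le_taylor2 (R : realFieldType) (v : R) : - 2^-1 <= v ->
  (1 + v)^-1 <= 1 - v + 2 * v ^+ 2.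
Proof.
move=> hv; have v0 : 0 < 1 + v by lra.
rewrite -[_^-1]mul1r ler_pdivrMr// -subr_ge0.
rewrite (_ : _ - _ = v ^+ 2 * (1 + 2 * v)); last by ring.
by rewrite mulr_ge0 ?sqr_ge0//; lra.
Qed.

Lemma nth_root_exists (R : realType) k (y : R) : (0 < k)%N -> 0 <= y ->
  exists2 Z : R, 0 <= Z & Z ^+ k = y.
Proof.
move=> k0 y0; exists (y `^ k%:R^-1); first exact: powR_ge0.
by rewrite -powR_mulrn ?powR_ge0// -powRrM mulVf ?powRr1// pnatr_eq0 -lt0n.
Qed.

(** The power of the mean lies between the products of the [y p] and of the [z p], and each [y p] is
    at most [t ^+ 2 * e] below [z p]; [prod_seq_perturb] then bounds the gap. The margin [15 * e]
    makes the [u p n] positive, [r p] at most 1, and the relative deviations at least [- 2^-1]. *)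
Lemma power_mean_prod (R : realType) (I : eqType) (N : nat) (s : seq I)
    (u : I -> 'I_N -> R) (d : 'I_N -> R) (z : I -> R) (e t : R) :
  (0 < N)%N -> (0 < size s)%N -> 0 < e -> 0 <= t -> t <= 1 ->
  (forall n, 0 <= d n) ->
  (forall n, d n ^+ size s = \prod_(p <- s) u p n) ->
  {in s, forall p, \sum_n u p n = N%:R * z p} ->
  {in s, forall p, 15 * e <= z p} ->
  (forall n, {in s, forall p, `|u p n - z p| <= 2 * (t * e)}) ->
  `|((\sum_n d n) / N%:R) ^+ size s - \prod_(p <- s) z p|
    <= t ^+ 2 * \prod_(p <- s) (z p + e).
Proof.
move=> N0 s0 e0 t0 t1 d0 dE zE ze uz.
have te : t * e <= e by rewrite ler_piMl// ltW.
have te0 : 0 <= t * e by rewrite mulr_ge0// ltW.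
have z0 p : p \in s -> 0 < z p by move=> /ze; lra.
have u0 n : {in s, forall p, 0 < u p n}.
  move=> p ps; have := uz n _ ps; have := ze _ ps; rewrite ler_norml; lra.
(* y p is a lower bound for the harmonic mean of the u p n. *)
pose r p := 8 * (t * e) ^+ 2 / z p ^+ 2.
pose y p := z p * (1 - r p).
have r0 p : 0 <= r p.
  by rewrite /r mulr_ge0 ?invr_ge0 ?sqr_ge0// mulr_ge0// sqr_ge0.
have zr p : p \in s -> z p * r p <= t ^+ 2 * e.
  move=> ps; have zp := z0 _ ps.
  rewrite /r (_ : _ * _ = t ^+ 2 * e * (8 * e / z p)); last first.
    by field; rewrite gt_eqF.
  rewrite ler_piMr// ?mulr_ge0 ?sqr_ge0 ?(ltW e0)//.
  by rewrite ler_pdivrMr// mul1r; have := ze _ ps; lra.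
have t21 : t ^+ 2 <= 1 by rewrite expr_le1.
have r1 p : p \in s -> r p <= 1.
  move=> ps; have zp := z0 _ ps.
  rewrite -(ler_pM2l zp) mulr1 (le_trans (zr _ ps))//.
  have := ler_wpM2r (ltW e0) t21; have := ze _ ps; lra.
have y0 p : p \in s -> 0 <= y p.
  by move=> ps; rewrite mulr_ge0 ?subr_ge0 ?r1// ltW// z0.
have yu p : p \in s -> \sum_n y p / u p n <= N%:R.
  move=> ps; have zp := z0 _ ps.
  have H n : y p / u p n <= (1 - r p) * (1 + r p - (u p n - z p) / z p).
    pose v := (u p n - z p) / z p.
    have uv : u p n = z p * (1 + v) by rewrite /v; field; rewrite gt_eqF.
    (* The constant 8 in [r p] is twice the square of the 2 in the bound on [u p n - z p]. *)
    have v2 : 2 * v ^+ 2 <= r p.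
      rewrite /v /r expr_div_n mulrA ler_pM2r ?invr_gt0 ?exprn_gt0//.
      have : `|u p n - z p| ^+ 2 <= (2 * (t * e)) ^+ 2.
        by apply: lerXn2r; rewrite ?nnegrE ?normr_ge0 ?uz// mulr_ge0.
      by rewrite real_normK ?num_real// exprMn; lra.
    have hv : - 2^-1 <= v.
      rewrite /v ler_pdivlMr//; have := uz n _ ps; have := ze _ ps.
      by rewrite ler_norml; lra.
    rewrite uv /y invfM mulrACA mulfV ?gt_eqF// mul1r.
    rewrite ler_wpM2l ?subr_ge0 ?r1//.
    have := inv_le_taylor2 hv; rewrite -uv -/v; lra.
  apply: (le_trans (ler_sum _ (fun n _ => H n))).
  (* The first-order terms cancel because [z p] is the mean of the [u p n]; there remains [N] times
     [1 - r p ^+ 2]. *)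
  rewrite -mulr_sumr sumrB -mulr_suml sumrB zE// !sumr_const card_ord.
  rewrite -[z p *+ N]mulr_natl subrr mul0r subr0.
  rewrite -[(1 + r p) *+ N]mulr_natr mulrA.
  rewrite ler_piMl// (_ : _ * _ = 1 - r p ^+ 2); last by ring.
  by have := sqr_ge0 (r p); lra.
have P0 (w : I -> R) : {in s, forall p, 0 <= w p} -> 0 <= \prod_(p <- s) w p.
  by move=> w0; rewrite big_seq prodr_ge0.
have [Z Z0 ZE] := nth_root_exists s0 (P0 z (fun p ps => ltW (z0 p ps))).
have [Y Y0 YE] := nth_root_exists s0 (P0 y y0).
have dZ := power_mean_le N0 s0 u0 d0 dE Z0 ZE
  (fun p ps => conj (z0 p ps) (zE p ps)).
have dY := power_mean_ge N0 s0 u0 d0 dE Y0 YE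
  (fun p ps => conj (y0 p ps) (yu p ps)).
have dd : 0 <= (\sum_n d n) / N%:R by exact: le_trans dY.
have {}dZ : ((\sum_n d n) / N%:R) ^+ size s <= \prod_(p <- s) z p.
  by rewrite -ZE ler_pXn2r.
have {}dY : \prod_(p <- s) y p <= ((\sum_n d n) / N%:R) ^+ size s.
  by rewrite -YE ler_pXn2r.
have := @prod_seq_perturb R I z y e (t ^+ 2) s (ltW e0) (sqr_ge0 t).
rewrite distrC ger0_norm ?subr_ge0// => H.
apply: le_trans (H _); first lra.
move=> p ps; split; first exact: y0.
  by rewrite /y ler_piMr ?(ltW (z0 _ ps))//; have := r0 p; lra.
by rewrite /y (_ : _ - _ = z p * r p) ?zr//; ring.
Qed.

(** * Means of complex roots *)

Section real_complex_facts.
Variable R : realType.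
Local Notation C := (real_complex R).
Implicit Types (z : R[i]) (y : R).

Lemma normr_complex_Re z y : `|z| <= C y -> `|complex.Re z| <= y.
Proof. by move=> zy; rewrite -lecR; exact: le_trans (normc_ge_Re z) zy. Qed.

Lemma normr_complex_Im z y : `|z| <= C y -> `|complex.Im z| <= y.
Proof.
move=> zy; rewrite -normrN -ReiNIm; apply: normr_complex_Re.
suff Ni : `|'i%C| = 1 :> R[i] by rewrite normrM Ni mulr1.
by rewrite normc_def /= expr0n expr1n/= add0r sqrtr1.
Qed.

Lemma normr_real_complex y : `|C y| = C `|y|.
Proof. by rewrite normc_def /= expr0n/= addr0 sqrtr_sqr. Qed.

Lemma Re_real_complexM y z : complex.Re (C y * z) = y * complex.Re z.
Proof. by case: z => a b /=; rewrite mul0r subr0. Qed.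

Lemma Im_real_complexM y z : complex.Im (C y * z) = y * complex.Im z.
Proof. by case: z => a b /=; rewrite mul0r addr0. Qed.

Lemma Re_sum (I : Type) (s : seq I) (P : pred I) (F : I -> R[i]) :
  complex.Re (\sum_(j <- s | P j) F j) = \sum_(j <- s | P j) complex.Re (F j).
Proof. by elim/big_rec2: _ => // j y z _ <-; case: (F j) => ? ?; case: z. Qed.

Lemma Im_sum (I : Type) (s : seq I) (P : pred I) (F : I -> R[i]) :
  complex.Im (\sum_(j <- s | P j) F j) = \sum_(j <- s | P j) complex.Im (F j).
Proof. by elim/big_rec2: _ => // j y z _ <-; case: (F j) => ? ?; case: z. Qed.

Lemma rootC_real_complex k y : (0 < k)%N -> 0 <= y ->
  k.-root (C (y ^+ k)) = C y.
Proof. by move=> k0 y0; rewrite rmorphXn/= exprCK// ler0c. Qed.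

End real_complex_facts.

Section mixed_mean.
Variables (R : realType) (I : eqType) (N : nat).
Hypothesis N_gt0 : (0 < N)%N.
Implicit Types (s : seq I) (X : I -> 'I_N -> R) (x : I -> R).
Local Notation C := (real_complex R).

(** A diagonal entry of [diag_root], with the multi-index replaced by a word and the degree by its
    length. *)
Definition word_root s X n : R[i] :=
  (size s).-root (C (\prod_(p <- s) X p n)).

(** The trace of [Omega1] times the diagonal matrix of the roots; powers of this rank-one matrix
    reduce to powers of this number. *)
Definition word_mean s X : R[i] := (\sum_n word_root s X n) / N%:R.

Definition avg X p : R := (\sum_n X p n) / N%:R.

Let N0 : 0 < N%:R :> R. Proof. by rewrite ltr0n. Qed.

Lemma normr_mean_le (K : numFieldType) (F : 'I_N -> K) y :
  (forall n, `|F n| <= y) -> `|(\sum_n F n) / N%:R| <= y.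
Proof.
move=> Fy; have N0' : 0 < N%:R :> K by rewrite ltr0n.
rewrite normrM normfV (gtr0_norm N0') ler_pdivrMr// (le_trans (ler_norm_sum _ _ _))//.
by rewrite (le_trans (ler_sum _ (fun n _ => Fy n)))// sumr_const card_ord mulr_natr.
Qed.

Lemma mean_cst (K : numFieldType) (F : 'I_N -> K) y :
  (forall n, F n = y) -> (\sum_n F n) / N%:R = y.
Proof.
move=> Fy; rewrite (eq_bigr _ (fun n _ => Fy n)) sumr_const card_ord -[y *+ N]mulr_natr.
by rewrite mulfK// pnatr_eq0 -lt0n.
Qed.

Lemma normr_word_root s X n (Y : R) : (0 < size s)%N -> 0 <= Y ->
  \prod_(p <- s) `|X p n| <= Y ^+ size s -> `|word_root s X n| <= C Y.
Proof.
move=> s0 Y0 XY; rewrite /word_root norm_rootC normr_real_complex normr_prod.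
rewrite -(rootC_real_complex s0 Y0) ler_rootC// ?nnegrE ?ler0c ?lecR//.
  by apply: prodr_ge0 => p _.
exact: exprn_ge0.
Qed.

Section near_point.
Variables (s : seq I) (X : I -> 'I_N -> R) (x : I -> R) (e t : R).
Hypotheses (e_gt0 : 0 < e) (t_ge0 : 0 <= t) (t_le1 : t <= 1).
Hypothesis Xx : forall p n, `|X p n - x p| <= t * e.

Let te_ge0 : 0 <= t * e. Proof. by rewrite mulr_ge0// ltW. Qed.
Let te_le : t * e <= e. Proof. by rewrite ler_piMl// ltW. Qed.

Lemma avg_near p : `|avg X p - x p| <= t * e.
Proof.
have -> : avg X p - x p = (\sum_n (X p n - x p)) / N%:R.
  rewrite sumrB mulrBl sumr_const card_ord -[x p *+ N]mulr_natr mulfK//.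
  by rewrite gt_eqF.
exact: normr_mean_le.
Qed.

Lemma normr_near y p : `|y - x p| <= t * e -> `|y| <= `|x p| + t * e.
Proof.
by move=> yx; rewrite -[y](subrK (x p)) addrC (le_trans (ler_normD _ _))// lerD2l.
Qed.

Lemma prod_shift_ge0 (a : R) : 0 <= a -> 0 <= \prod_(p <- s) (`|x p| + a).
Proof. by move=> a0; apply: prodr_ge0 => p _; exact: addr_ge0. Qed.

Lemma prod_shift_le (a b : R) : 0 <= a -> a <= b ->
  \prod_(p <- s) (`|x p| + a) <= \prod_(p <- s) (`|x p| + b).
Proof.
by move=> a0 ab; apply: ler_prod => p _; rewrite lerD2l ab andbT addr_ge0.
Qed.

(** A single real [Y] controls all the roots and their mean; its power is the shifted product used
    as majorant. *)
Lemma word_mean_bound : (0 < size s)%N ->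
  exists2 Y : R, 0 <= Y /\ Y ^+ size s = \prod_(p <- s) (`|x p| + t * e) &
    (forall n, `|word_root s X n| <= C Y) /\ `|word_mean s X| <= C Y.
Proof.
move=> s0; have [Y Y0 YE] := nth_root_exists s0 (prod_shift_ge0 te_ge0).
exists Y => //.
have H n : `|word_root s X n| <= C Y.
  apply: normr_word_root => //; rewrite YE.
  by apply: ler_prod => p _; rewrite normr_ge0 normr_near.
by split=> //; exact: normr_mean_le.
Qed.

(** A letter with [x p = 0] contributes [t * e] on the left and [e] on the right, hence a factor
    [t]. Two such letters give [t ^+ 2], and further ones do no harm since [t <= 1]. *)
Lemma prod_shift_zeros : (1 < count (fun p => x p == 0%R) s)%N ->
  \prod_(p <- s) (`|x p| + t * e) <= t ^+ 2 * \prod_(p <- s) (`|x p| + e).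
Proof.
move=> c2.
have t1n j : (2 <= j)%N -> t ^+ j <= t ^+ 2.
  by move=> j2; rewrite -(subnK j2) exprD ler_piMl ?exprn_ge0// exprn_ile1.
apply: le_trans (_ : t ^+ count (fun p => x p == 0%R) s *
  \prod_(p <- s) (`|x p| + e) <= _); last first.
  by rewrite ler_wpM2r ?t1n// prod_shift_ge0// ltW.
elim: (s) => [|p s' IH] /=; first by rewrite !big_nil expr0 mulr1.
rewrite !big_cons; case: eqVneq => [->|xp]; rewrite ?add1n ?add0n.
  rewrite normr0 !add0r exprS mulrACA ler_wpM2l//.
rewrite mulrCA; apply: ler_pM => //; first exact: addr_ge0.
  by apply: prodr_ge0 => q _; exact: addr_ge0.
by rewrite lerD2l.
Qed.

Lemma word_mean_near_zeros : (1 < count (fun p => x p == 0%R) s)%N ->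
  `|word_mean s X ^+ size s - C (\prod_(p <- s) avg X p)| <=
  C (2 * t ^+ 2 * \prod_(p <- s) (`|x p| + 2 * e)).
Proof.
move=> c2; have s0 : (0 < size s)%N.
  by apply: leq_trans (count_size _ s); exact: ltnW c2.
have H := prod_shift_zeros c2.
have H2 : \prod_(p <- s) (`|x p| + e) <= \prod_(p <- s) (`|x p| + 2 * e).
  by apply: prod_shift_le; have := e_gt0; lra.
have {}H2 := ler_wpM2l (exprn_ge0 2 t_ge0) H2.
rewrite (le_trans (ler_normB _ _))// normr_real_complex normrX.
have [Y [Y0 YE] [_ hY]] := word_mean_bound s0.
have h1 : `|word_mean s X| ^+ size s <= C (\prod_(p <- s) (`|x p| + t * e)).
  by rewrite -YE rmorphXn/=; apply: lerXn2r; rewrite ?nnegrE ?normr_ge0 ?ler0c.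
have h2 : `|\prod_(p <- s) avg X p| <= \prod_(p <- s) (`|x p| + t * e).
  rewrite normr_prod; apply: ler_prod => p _.
  by rewrite normr_ge0 normr_near// avg_near.
rewrite (le_trans (lerD h1 (lexx _)))// -rmorphD/= lecR.
lra.
Qed.

(** Multiplying by the signs of the [x p] reduces to nonnegative factors. The product [sig] of these
    signs is the same for all copies, so its possibly complex root factors out of the mean, and the
    power gives back [sig], which also factors out of the product of averages. *)
Lemma word_mean_near_nonzero : (0 < size s)%N ->
  {in s, forall p, 16 * e <= `|x p|} ->
  `|word_mean s X ^+ size s - C (\prod_(p <- s) avg X p)| <=
  C (2 * t ^+ 2 * \prod_(p <- s) (`|x p| + 2 * e)).
Proof.
move=> s0 xe.
pose g p : R := Num.sg (x p).
pose u p n := g p * X p n.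
have gx p : g p * x p = `|x p| by rewrite normrEsg.
have g1 p : p \in s -> `|g p| = 1.
  move=> /xe xp; rewrite normr_sg.
  by have -> : x p != 0 by rewrite -normr_gt0; have := e_gt0; lra.
have gg p : p \in s -> g p * g p = 1.
  by move=> /g1 gp; rewrite -expr2 -real_normK ?num_real// gp expr1n.
have ux n p : p \in s -> `|u p n - `|x p| | <= t * e.
  by move=> ps; rewrite -gx -mulrBr normrM g1// mul1r.
have u0 n p : p \in s -> 0 <= u p n.
  move=> ps; have := ux n p ps; rewrite ler_norml => /andP[+ _].
  by have := xe _ ps; have := te_le; have := e_gt0; lra.
have U0 n : 0 <= \prod_(p <- s) u p n.
  by rewrite big_seq; apply: prodr_ge0 => p; exact: u0.
pose sig : R := \prod_(p <- s) g p.
have XE n : \prod_(p <- s) X p n = sig * \prod_(p <- s) u p n.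
  rewrite -big_split/= big_seq [RHS]big_seq; apply: eq_bigr => p ps.
  by rewrite mulrA gg// mul1r.
pose d n := s2val (cid2 (nth_root_exists s0 (U0 n))).
have d0 n : 0 <= d n := s2valP (cid2 (nth_root_exists s0 (U0 n))).
have dE n : d n ^+ size s = \prod_(p <- s) u p n.
  exact: s2valP' (cid2 (nth_root_exists s0 (U0 n))).
(* The root of the product splits because the factor [C (d n ^+ size s)] is nonnegative. *)
have wE n : word_root s X n = C (d n) * (size s).-root (C sig).
  have dk : 0 <= C (d n ^+ size s) by rewrite ler0c exprn_ge0.
  by rewrite /word_root XE -dE rmorphM/= rootCMr// rootC_real_complex// mulrC.
have hE : word_mean s X ^+ size s = C (sig * ((\sum_n d n) / N%:R) ^+ size s).
  rewrite /word_mean; under eq_bigr do rewrite wE.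
  rewrite -mulr_suml mulrAC exprMn rootCK// -rmorph_sum/= mulrC.
  by rewrite rmorphM rmorphXn/= fmorph_div/= rmorph_nat.
have aE : \prod_(p <- s) avg X p = sig * \prod_(p <- s) avg u p.
  rewrite -big_split/= big_seq [RHS]big_seq; apply: eq_bigr => p ps.
  by rewrite /avg -mulr_sumr !mulrA gg// mul1r.
have avgx p : p \in s -> `|avg u p - `|x p| | <= t * e.
  move=> ps; rewrite /avg -mulr_sumr -gx -mulrA -mulrBr normrM g1// mul1r.
  exact: avg_near.
rewrite hE aE -rmorphB/= -mulrBr normr_real_complex lecR normrM.
have -> : `|sig| = 1.
  by rewrite /sig normr_prod big_seq big1// => p /g1.
rewrite mul1r.
have uS : {in s, forall p, \sum_n u p n = N%:R * avg u p}.
  by move=> p _; rewrite /avg mulrC mulfVK// gt_eqF.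
(* Averages differ from [|x p|] by at most [t * e <= e], which turns the margin 16 into 15. *)
have ue : {in s, forall p, 15 * e <= avg u p}.
  move=> p ps; have := avgx p ps; have := xe p ps; have := te_le.
  by rewrite ler_norml; lra.
have ua n : {in s, forall p, `|u p n - avg u p| <= 2 * (t * e)}.
  move=> p ps; have := avgx p ps; have := ux n p ps; rewrite !ler_norml; lra.
have H := power_mean_prod N_gt0 s0 e_gt0 t_ge0 t_le1 d0 dE uS ue ua.
apply: (le_trans H).
have P0 : 0 <= \prod_(p <- s) (`|x p| + 2 * e).
  by apply: prod_shift_ge0; have := e_gt0; lra.
(* One [e] covers the displacement of the average, the other the perturbation of the product: hence
   the shift [2 * e] in the majorants. *)
have H1 : \prod_(p <- s) (avg u p + e) <= \prod_(p <- s) (`|x p| + 2 * e).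
  rewrite big_seq [leRHS]big_seq; apply: ler_prod => p ps.
  by have := avgx p ps; have := xe p ps; have := te_le; rewrite ler_norml; lra.
have := ler_wpM2l (exprn_ge0 2 t_ge0) H1.
have := mulr_ge0 (exprn_ge0 2 t_ge0) P0; lra.
Qed.

Lemma word_mean_near : (0 < size s)%N ->
  (forall p, x p != 0 -> 16 * e <= `|x p|) ->
  ((1 < size s)%N -> count (fun p => x p == 0%R) s != 1%N) ->
  `|word_mean s X ^+ size s - C (\prod_(p <- s) avg X p)| <=
  C (2 * t ^+ 2 * \prod_(p <- s) (`|x p| + 2 * e)).
Proof.
move=> s0 xe reg.
(* For a one-letter word the mean of first roots is the average itself and the difference is 0. For
   longer words [reg] leaves no vanishing letter or at least two. *)
have [s1|s1] := ltnP 1 (size s); last first.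
  have : size s = 1%N by apply/eqP; rewrite eqn_leq s1.
  have P0 : 0 <= 2 * t ^+ 2 * \prod_(p <- s) (`|x p| + 2 * e).
    rewrite !mulr_ge0// ?exprn_ge0// prod_shift_ge0//; have := e_gt0; lra.
  move: P0; rewrite /word_mean /word_root; case: s => [//|p [|//]] P0 _.
  rewrite /= expr1 big_seq1 /avg; under eq_bigr do rewrite root1C big_seq1.
  by rewrite -rmorph_sum/= fmorph_div/= rmorph_nat subrr normr0 ler0c.
case: (ltngtP 1%N (count (fun p => x p == 0%R) s)) => [|c1|/esym/eqP c1].
- exact: word_mean_near_zeros.
- apply: word_mean_near_nonzero => // p ps; apply: xe; apply/negP => xp.
  by move: c1; rewrite ltnNge -has_count => /hasPn/(_ p ps); rewrite xp.
- by rewrite c1 in reg; have := reg s1.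
Qed.

End near_point.
End mixed_mean.

(** * The extended vector field *)

Section words_of_orderings.
Variable m : nat.

Lemma sum_count_mem (s : seq 'I_m) : (\sum_(l < m) count_mem l s)%N = size s.
Proof.
elim: s => [|p s IH] /=; first by rewrite big1.
rewrite big_split/= IH (bigD1 p)//= eqxx big1 ?addn0// => l /negbTE.
by rewrite eq_sym => ->.
Qed.

Lemma size_arrange (S : ordering m) J : size (S J) = mdeg J.
Proof.
by rewrite -sum_count_mem; apply: eq_bigr => l _; rewrite arrangeP.
Qed.

Lemma prod_count_mem (K : comPzRingType) (F : 'I_m -> K) (s : seq 'I_m) :
  \prod_(p <- s) F p = \prod_(l < m) F l ^+ count_mem l s.
Proof.
elim: s => [|p s IH] /=; first by rewrite big_nil big1// => l _; rewrite expr0.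
rewrite big_cons IH; under [in RHS]eq_bigr do rewrite exprD.
rewrite big_split/=; congr (_ * _).
rewrite (bigD1 p)//= eqxx expr1 big1 ?mulr1// => l /negbTE.
by rewrite eq_sym => ->; rewrite expr0.
Qed.

Lemma prod_arrange (K : comPzRingType) (F : 'I_m -> K) (S : ordering m) J :
  \prod_(p <- S J) F p = \prod_(l < m) F l ^+ J l.
Proof.
by rewrite prod_count_mem; apply: eq_bigr => l _; rewrite arrangeP.
Qed.

(** Translates the partial degree in [mc_regular] into the count of vanishing letters in
    [word_mean_near]. *)
Lemma count_arrange (P : pred 'I_m) (S : ordering m) J :
  count P (S J) = (\sum_(l < m | P l) J l)%N.
Proof.
rewrite -[LHS]size_filter -sum_count_mem (bigID P)/= [X in (_ + X)%N]big1 ?addn0.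
  by apply: eq_bigr => l Pl; rewrite -(arrangeP S) count_filter; apply: eq_count => q /=;
     case: eqP => // ->; rewrite Pl.
move=> l /negbTE Pl; apply/eqP; rewrite eqn0Ngt -has_count -all_predC.
by apply/allP => q; rewrite mem_filter /=; case: eqP => // ->; rewrite Pl.
Qed.

End words_of_orderings.

Section mc_field.
Variables (R : realType) (m N : nat).
Hypothesis N_gt0 : (0 < N)%N.
Local Notation C := (real_complex R).
Implicit Types (S : ordering m) (a : ('I_m -> nat) -> R) (X : 'M[R]_(m, N)).

Lemma prod_diag_component X (s : seq 'I_m) :
  \prod_(p <- s) diag_component p X =
  diag_mx (\row_n C (\prod_(p <- s) X p n)).
Proof.
elim: s => [|p s IH].
  by rewrite big_nil; apply/matrixP => i j; rewrite !mxE big_nil rmorph1.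
rewrite big_cons IH /diag_component -[_ * _]/(_ *m _) mulmx_diag.
by congr diag_mx; apply/rowP => n; rewrite !mxE big_cons rmorphM.
Qed.

Lemma diag_rootE S k J X : mdeg J = k ->
  diag_root S k J X = diag_mx (\row_n word_root (S J) X n).
Proof.
move=> <-; rewrite /diag_root prod_diag_component; congr diag_mx; apply/rowP => n.
by rewrite !mxE eqxx mulr1n /word_root size_arrange.
Qed.

(** The matrix is the outer product of a constant column and [d], so each further factor contributes
    only the scalar product of the two, the mean of [d]. *)
Lemma expr_Omega1_diag (K : numFieldType) (d : 'rV[K]_N) k n l :
  ((Omega1 K N *m diag_mx d) ^+ k.+1) n l =
  N%:R^-1 * d 0 l * ((\sum_n d 0 n) / N%:R) ^+ k.
Proof.
elim: k n l => [|k IH] n l.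
  by rewrite expr1 expr0 mulr1 mul_mx_diag !mxE.
rewrite exprS -[_ * _]/(_ *m _) mxE.
under eq_bigr do rewrite IH mul_mx_diag 2!mxE.
rewrite -mulr_suml exprS.
rewrite (_ : \sum_i N%:R^-1 * d 0 i = (\sum_i d 0 i) / N%:R); last first.
  by rewrite mulr_suml; apply: eq_bigr => i _; rewrite mulrC.
by ring.
Qed.

(** The value shared by all entries in column [l] of [mc_term] at degree [k.+1]. *)
Definition mc_coef S a X l k : R[i] :=
  \sum_(J : {ffun 'I_m -> 'I_k.+2} | mdeg (mexp J) == k.+1)
    C (a (mexp J)) * (N%:R^-1 * word_root (S (mexp J)) X l *
                      word_mean (S (mexp J)) X ^+ k).

(** The limits are taken column by column, as in [mc_map], so that [ext_fieldE] holds at every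
    state, whether or not the series converge there. *)
Definition mc_field S a X : R[i] :=
  C (a (fun=> 0%N)) + \sum_l Climn (series (mc_coef S a X l)).

Lemma mc_termE S a k X n l : mc_term S a k.+1 X n l = mc_coef S a X l k.
Proof.
rewrite /mc_term summxE; apply: eq_bigr => J /eqP Jk.
rewrite mxE (diag_rootE _ _ Jk) expr_Omega1_diag mxE.
by congr (_ * (_ * _ ^+ _)); rewrite /word_mean; under eq_bigr do rewrite mxE.
Qed.

Lemma mc_mapE S a X n l : mc_map S a X n l =
  C (a (fun=> 0%N)) *+ (n == l) + Climn (series (mc_coef S a X l)).
Proof.
rewrite !mxE; congr (_ + Climn (series _)).
by apply/funext => k; rewrite mc_termE.
Qed.

(** Left multiplication by [Omega1] averages the rows, which changes nothing in the part depending
    on the column only and spreads the constant term evenly; the all-ones vector then sums the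
    columns. *)
Lemma ext_fieldE S (a : 'I_m -> ('I_m -> nat) -> R)
    (Q : 'I_m -> 'M[R]_N -> 'M[R]_N) i X n :
  ext_field S a (linear_decay Q) i X n 0 =
  mc_field S (a i) X + C (\sum_l Q i (Omega1 R N) n l * X i l).
Proof.
have N0 : N%:R != 0 :> R[i] by rewrite pnatr_eq0 -lt0n.
rewrite /ext_field !mxE; congr (_ + C _); last first.
  by apply: eq_bigr => l _; rewrite !mxE.
rewrite (eq_bigr (fun l => N%:R^-1 * C (a i (fun=> 0%N)) +
    Climn (series (mc_coef S (a i) X l)))); last first.
  move=> l _; rewrite !mxE mulr1.
  under eq_bigr do rewrite mxE mc_mapE mulrDr.
  rewrite big_split/= sumr_const card_ord -[(_ * _) *+ N]mulr_natl (mulVKf N0).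
  rewrite (bigD1 l)//= eqxx mulr1n big1 ?addr0// => j /negbTE ->.
  by rewrite mulr0n mulr0.
rewrite big_split/= sumr_const card_ord -[(_ * _) *+ N]mulr_natl (mulVKf N0).
by [].
Qed.

Lemma mc_field_col_perm S a (g : 'S_N) X :
  mc_field S a (col_perm g X) = mc_field S a X.
Proof.
rewrite /mc_field; congr (_ + _).
have rE s n : word_root s (col_perm g X) n = word_root s X (g n).
  by rewrite /word_root; under eq_bigr do rewrite mxE.
have mE s : word_mean s (col_perm g X) = word_mean s X.
  rewrite /word_mean; under eq_bigr do rewrite rE.
  by rewrite [in RHS](reindex_inj (@perm_inj _ g)).
rewrite [RHS](reindex_inj (@perm_inj _ g))/=; apply: eq_bigr => l _.
congr (Climn (series _)); apply/funext => k; apply: eq_bigr => J _.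
by rewrite rE mE.
Qed.

End mc_field.

(** * Termwise operations on real series and domination *)

Section series_facts.
Variable R : realType.
Implicit Types (u v M : nat -> R).

Lemma cvg_series_sum (I : Type) (s : seq I) (P : pred I) (u : I -> nat -> R)
    (l : I -> R) : (forall j, series (u j) @ \oo --> l j) ->
  series (fun k => \sum_(j <- s | P j) u j k) @ \oo --> \sum_(j <- s | P j) l j.
Proof.
move=> ul; elim: s => [|j s IH].
  rewrite big_nil (_ : series _ = cst 0); first exact: cvg_cst.
  by apply/funext => n; rewrite seriesEnat /= big1// => k _; rewrite big_nil.
rewrite big_cons; case: ifPn => Pj; last first.
  by under eq_fun do rewrite big_cons (negbTE Pj).
rewrite (_ : series _ = series (u j) \+
    series (fun k => \sum_(j0 <- s | P j0) u j0 k)); first exact: cvgD.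
apply/funext => n; rewrite !seriesEnat /= -big_split/=.
by apply: eq_bigr => k _; rewrite big_cons Pj.
Qed.

Lemma cvg_seriesD u v (l l' : R) : series u @ \oo --> l ->
  series v @ \oo --> l' -> series (fun k => u k + v k) @ \oo --> l + l'.
Proof.
move=> ul vl; rewrite (_ : series _ = series u \+ series v); first exact: cvgD.
by apply/funext => n; rewrite !seriesEnat /= big_split.
Qed.

Lemma cvg_seriesZ (c : R) u (l : R) : series u @ \oo --> l ->
  series (fun k => c * u k) @ \oo --> c * l.
Proof.
move=> ul; rewrite (_ : series _ = fun n => c * series u n); first exact: cvgM (cvg_cst c) ul.
by apply/funext => n; rewrite !seriesEnat /= mulr_sumr.
Qed.

Lemma cvg_series_shift u (l : R) : series u @ \oo --> l ->
  series (fun k => u k.+1) @ \oo --> l - u 0%N.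
Proof.
move=> ul; rewrite (_ : series _ = fun n => series u n.+1 - u 0%N).
  by apply: cvgB; [rewrite (cvg_shiftS (series u)) | exact: cvg_cst].
by apply/funext => n; rewrite !seriesEnat /= big_nat_recl// addrC addKr.
Qed.

Lemma is_cvg_series_dominated u M : cvgn (series M) ->
  (forall k, `|u k| <= M k) -> cvgn (series u).
Proof.
move=> cM uM; apply: normed_cvg.
apply: (series_le_cvg _ _ uM cM) => k //.
exact: le_trans (normr_ge0 _) (uM k).
Qed.

Lemma lim_series_dominated u M (c l L : R) : series u @ \oo --> l ->
  series M @ \oo --> L -> (forall k, `|u k| <= c * M k) -> `|l| <= c * L.
Proof.
move=> ul ML uM; have cL := cvg_seriesZ (c := c) ML.
have -> : `|l| = limn (fun n => `|series u n|) by rewrite (cvg_lim _ (cvg_norm ul)).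
rewrite -(cvg_lim _ cL)//; apply: ler_lim.
- by apply/cvg_ex; exists `|l|; exact: cvg_norm.
- by apply/cvg_ex; exists (c * L).
apply: nearW => n; rewrite !seriesEnat /= (le_trans (ler_norm_sum _ _ _))//.
exact: ler_sum.
Qed.

End series_facts.

(** * Values of the scalar field on synchronised states and convergence near them *)

Section mc_field_values.
Variables (R : realType) (m N : nat).
Hypothesis N_gt0 : (0 < N)%N.
Local Notation C := (real_complex R).
Variables (S : ordering m) (a : ('I_m -> nat) -> R) (f : 'rV[R]_m -> R).
Variable r : 'I_m -> R.
Hypothesis hf : taylor_expansion r f a.
Implicit Types (X : 'M[R]_(m, N)) (x : 'rV[R]_m).

Let N0 : N%:R != 0 :> R. Proof. by rewrite pnatr_eq0 -lt0n. Qed.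

Definition taylor_sum x k : R :=
  \sum_(J : {ffun 'I_m -> 'I_k.+1} | mdeg (mexp J) == k)
    a (mexp J) * monomial (mexp J) x.

Lemma taylor_sum0 x : taylor_sum x 0 = a (fun=> 0%N).
Proof.
have J0 (J : {ffun 'I_m -> 'I_1}) : mexp J = fun=> 0%N.
  by apply/funext => l; rewrite /mexp ord1.
have d0 : mdeg ((fun=> 0%N) : 'I_m -> nat) = 0%N by rewrite /mdeg big1.
rewrite /taylor_sum (big_pred1 [ffun=> ord0]); last first.
  by move=> J /=; rewrite J0 d0 eqxx; apply/esym/eqP/ffunP => l; rewrite !ord1.
by rewrite J0 /monomial big1 ?mulr1// => l _; rewrite expr0.
Qed.

Lemma taylor_sum_cvg x : (forall l, `|x 0 l| < r l) ->
  series (fun k => taylor_sum x k.+1) @ \oo --> f x - a (fun=> 0%N).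
Proof.
by move=> xr; rewrite -(taylor_sum0 x); apply: cvg_series_shift; have [] := hf xr.
Qed.

Lemma monomialE J x : monomial J x = \prod_(p <- S J) x 0 p.
Proof. by rewrite prod_arrange. Qed.

Lemma Climn_real_complex (u : nat -> R) (l : R) : u @ \oo --> l ->
  Climn (fun n => C (u n)) = C l.
Proof.
by move=> ul; rewrite /Climn/= (cvg_lim _ ul)// lim_cst.
Qed.

(** At a synchronised state all copies have the same root, so the mean is this root, and its
    [k.+1]-st power is the monomial whichever branch the root lies on. *)
Lemma mc_coef_lift x l k : mc_coef S a (lift_state N x) l k =
  C (N%:R^-1 * taylor_sum x k.+1).
Proof.
rewrite /mc_coef /taylor_sum mulr_sumr rmorph_sum/=; apply: eq_bigr => J /eqP Jk.
have sJ : size (S (mexp J)) = k.+1 by rewrite size_arrange.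
set s := S (mexp J).
have wE n : word_root s (lift_state N x) n = k.+1.-root (C (\prod_(p <- s) x 0 p)).
  by rewrite /word_root sJ; under eq_bigr do rewrite mxE.
rewrite /word_mean (mean_cst N_gt0 (fun n => wE n)) wE -mulrA -exprS rootCK//.
rewrite -monomialE mulrCA !rmorphM/= fmorphV rmorph_nat; ring.
Qed.

Lemma mc_field_lift x : (forall l, `|x 0 l| < r l) ->
  mc_field S a (lift_state N x) = C (f x).
Proof.
move=> xr; have H := cvg_seriesZ (c := N%:R^-1) (taylor_sum_cvg xr).
rewrite /mc_field.
rewrite (eq_bigr (fun=> C (N%:R^-1 * (f x - a (fun=> 0%N))))); last first.
  move=> l _; rewrite -(Climn_real_complex H); congr Climn.
  apply/funext => n; rewrite !seriesEnat /= rmorph_sum/=.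
  by apply: eq_bigr => k _; rewrite mc_coef_lift.
rewrite sumr_const card_ord -rmorphMn -rmorphD/= -mulr_natl (mulVKf N0).
by rewrite addrC subrK.
Qed.

Section near_point.
Variables (x : 'rV[R]_m) (e : R).
Hypotheses (e_gt0 : 0 < e) (xr : forall l, `|x 0 l| + 2 * e < r l).

Let shift_prod (s : seq 'I_m) := \prod_(p <- s) (`|x 0 p| + 2 * e).

Let e2 : 0 <= 2 * e. Proof. by have := e_gt0; lra. Qed.

Lemma shift_prod_ge0 s : 0 <= shift_prod s.
Proof. by apply: prodr_ge0 => p _; exact: addr_ge0. Qed.

(** Degree [k] part of the absolute Taylor series at the point with coordinates [|x 0 p| + 2 * e];
    it dominates both the values and the errors. *)
Definition taylor_major k : R :=
  \sum_(J : {ffun 'I_m -> 'I_k.+1} | mdeg (mexp J) == k)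
    `|a (mexp J)| * shift_prod (S (mexp J)).

Lemma taylor_major_cvg : cvgn (series (fun k => taylor_major k.+1)).
Proof.
pose y : 'rV[R]_m := \row_l (`|x 0 l| + 2 * e).
have yr l : `|y 0 l| < r l by rewrite mxE ger0_norm ?addr_ge0.
have [cM _] := hf yr.
apply/cvg_ex; eexists; apply: cvg_series_shift.
move: cM; congr (cvgn (series _)); apply/funext => k; apply: eq_bigr => J _.
rewrite normrM monomialE; congr (_ * _); rewrite ger0_norm.
  by apply: eq_bigr => p _; rewrite mxE.
by apply: prodr_ge0 => p _; rewrite mxE addr_ge0.
Qed.

Section state.
Variables (X : 'M[R]_(m, N)) (t : R).
Hypotheses (t_ge0 : 0 <= t) (t_le1 : t <= 1).
Hypothesis Xx : forall p n, `|X p n - x 0 p| <= t * e.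

Lemma mc_coef_le l k : `|mc_coef S a X l k| <= C (taylor_major k.+1).
Proof.
rewrite (le_trans (ler_norm_sum _ _ _))// rmorph_sum/=; apply: ler_sum => J /eqP Jk.
have sJ : size (S (mexp J)) = k.+1 by rewrite size_arrange.
rewrite normrM normr_real_complex rmorphM/= ler_wpM2l ?ler0c//.
have s0 : (0 < size (S (mexp J)))%N by rewrite sJ.
have [Y [Y0 YE] [hr hm]] := word_mean_bound N_gt0 e_gt0 t_ge0 Xx s0.
rewrite -mulrA normrM ger0_norm ?invr_ge0 ?ler0n//.
apply: (@le_trans _ _ (C (Y ^+ k.+1))).
  rewrite -[leRHS]mul1r; apply: ler_pM => //.
    by rewrite invf_le1 ?ler1n ?ltr0n.
  rewrite normrM normrX exprS rmorphM rmorphXn/=.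
  apply: ler_pM => //.
  by apply: lerXn2r; rewrite ?nnegrE ?normr_ge0 ?ler0c.
rewrite sJ in YE; rewrite lecR YE /shift_prod; apply: prod_shift_le.
  by rewrite mulr_ge0// ltW.
by have := e_gt0; have := ler_wpM2r (ltW e_gt0) t_le1; lra.
Qed.

Definition mc_sum k : R[i] :=
  \sum_(J : {ffun 'I_m -> 'I_k.+2} | mdeg (mexp J) == k.+1)
    C (a (mexp J)) * word_mean (S (mexp J)) X ^+ k.+1.

(** Summing over the columns turns the single root in [mc_coef] into one more factor [word_mean]. *)
Lemma sum_mc_coef k : \sum_l mc_coef S a X l k = mc_sum k.
Proof.
rewrite exchange_big/=; apply: eq_bigr => J _; rewrite -mulr_sumr; congr (_ * _).
by rewrite -mulr_suml -mulr_sumr exprS mulrC [N%:R^-1 * _]mulrC mulrC.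
Qed.

Lemma mc_field_cvg :
  series (fun k => complex.Re (mc_sum k)) @ \oo -->
    complex.Re (mc_field S a X) - a (fun=> 0%N) /\
  series (fun k => complex.Im (mc_sum k)) @ \oo --> complex.Im (mc_field S a X).
Proof.
(* One argument for both parts, [P] being [complex.Re] or [complex.Im]: every column series
   converges by domination, so the finite sum over columns commutes with the limit. *)
have H (P : R[i] -> R) :
    (forall z y, `|z| <= C y -> `|P z| <= y) ->
    (forall (J : Type) (s : seq J) (Q : pred J) F,
       P (\sum_(j <- s | Q j) F j) = \sum_(j <- s | Q j) P (F j)) ->
    series (fun k => P (mc_sum k)) @ \oo -->
      \sum_l limn (fun n => P (series (mc_coef S a X l) n)).
  move=> P1 P2.
  have cu l : cvgn (series (fun k => P (mc_coef S a X l k))).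
    by apply: (is_cvg_series_dominated taylor_major_cvg) => k; exact/P1/mc_coef_le.
  rewrite (eq_bigr (fun l => limn (series (fun k => P (mc_coef S a X l k))))).
    rewrite (_ : (fun k => _) = fun k => \sum_l P (mc_coef S a X l k)).
      by apply: cvg_series_sum => l; exact: cu.
    by apply/funext => k; rewrite -sum_mc_coef P2.
  move=> l _; congr (limn _).
  by apply/funext => n; rewrite !seriesEnat /= P2.
have HR := H _ (@normr_complex_Re R) (@Re_sum R).
have HI := H _ (@normr_complex_Im R) (@Im_sum R).
split.
  by rewrite /mc_field raddfD/= Re_sum addrAC subrr add0r.
by rewrite /mc_field raddfD/= Im_sum add0r.
Qed.

End state.
End near_point.
End mc_field_values.

(** * Derivatives *)

Section derivative_facts.
Variable R : realType.

(** A directional derivative sees only the restriction to a line near the point. The difference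
    quotients agree near 0, so the equality holds whether or not the limit exists. *)
Lemma derive_eq_line (V1 V2 : normedModType R) (g1 : V1 -> R) (g2 : V2 -> R)
    (a1 v1 : V1) (a2 v2 : V2) :
  (\forall h \near (0 : R), g1 (h *: v1 + a1) = g2 (h *: v2 + a2)) ->
  'D_v1 g1 a1 = 'D_v2 g2 a2.
Proof.
move=> H; have H0 : g1 a1 = g2 a2.
  by have := nbhs_singleton H; rewrite !scale0r !add0r.
rewrite /derive; congr (lim _).
have E : {near 0^', (fun h : R => h^-1 *: ((g1 \o shift a1) (h *: v1) - g1 a1)) =1
    (fun h : R => h^-1 *: ((g2 \o shift a2) (h *: v2) - g2 a2))}.
  by apply: nbhs_dnbhs; near do rewrite /= H0; near=> h; congr (_ *: (_ - _)); near: h.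
rewrite eqEsubset; split; apply: near_eq_cvg => //.
by near do apply/esym.
Unshelve. all: by end_near. Qed.

Lemma derive_affine (V : normedModType R) (g : V -> R) (a v : V) (c : R) :
  (forall h, g (h *: v + a) = g a + h * c) -> 'D_v g a = c.
Proof.
move=> H; apply/cvg_lim => //; apply: cvg_near_cst; near=> h.
rewrite /= H addrC addKr [_ *: _]mulKf//.
near: h; exact: nbhs_dnbhs_neq.
Unshelve. all: by end_near. Qed.

(** The bound makes [g] vanish at [p] and be [o(h)] there, so its differential is zero. *)
Lemma differentiable_quadratic (V : normedModType R) (g : V -> R) (p : V)
    (e c : R) : 0 < e ->
  (forall h, `|h| <= e -> `|g (p + h)| <= c * `|h| ^+ 2) -> differentiable g p.
Proof.
move=> e0 H.
have gp : g p = 0.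
  apply/eqP; rewrite -normr_le0; have := H 0.
  by rewrite normr0 addr0 expr0n mulr0; apply; exact: ltW.
have D : g \o shift p = cst (g p) + \0 +o_ (0 : V) id.
  apply/eqaddoP => _/posnumP[d]; near=> h.
  rewrite /= !fctE gp addr0 subr0 addrC.
  have c1 : 0 < `|c| + 1 by rewrite ltr_wpDl.
  have he : `|h| <= e by near: h; exact: nbhs0_le.
  apply: (le_trans (H h he)) => {he}.
  rewrite expr2 mulrA ler_wpM2r//.
  apply: (@le_trans _ _ ((`|c| + 1) * `|h|)).
    by rewrite ler_wpM2r// (le_trans (ler_norm c))// lerDl.
  rewrite mulrC -ler_pdivlMr//.
apply/diff_locallyP; rewrite (diff_unique _ D); last exact: cst_continuous.
by split=> //; exact: cst_continuous.
Unshelve. all: by end_near. Qed.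

Lemma differentiable_mx_form (m n : nat) (c : 'I_m -> 'I_n -> R)
    (p : 'M[R]_(m, n)) :
  differentiable (fun X : 'M[R]_(m, n) => \sum_i \sum_j c i j * X i j) p.
Proof.
rewrite (_ : (fun _ => _) = \sum_i \sum_j
    (c i j *: (fun X : 'M[R]_(m, n) => X i j : R))); last first.
  apply/funext => X; rewrite fct_sumE; apply: eq_bigr => i _.
  by rewrite fct_sumE.
do 2 apply: differentiable_sum => ?.
exact/differentiableZ/differentiable_coord.
Qed.

Lemma normr_entry_le (m n : nat) (M : 'M[R]_(m, n)) i j : `|M i j| <= `|M|.
Proof.
rewrite [leRHS]mx_normrE.
exact: (le_bigmax _ (fun ij : 'I_m * 'I_n => `|M ij.1 ij.2|) (i, j)).
Qed.

(** The margin [2 * e] keeps the point of [taylor_major] inside the polydisc, and [16 * e] is the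
    separation from 0 asked by [word_mean_near]. These are finitely many conditions, each true for
    all small positive [e]. *)
Lemma polydisc_margin (m : nat) (x : 'rV[R]_m) (r : 'I_m -> R) :
  (forall l, `|x 0 l| < r l) ->
  exists2 e : R, 0 < e & forall l, `|x 0 l| + 2 * e < r l /\
    (x 0 l != 0 -> 16 * e <= `|x 0 l|).
Proof.
move=> xr.
have H : \forall e \near 0^'+, 0 < e /\ forall l, `|x 0 l| + 2 * e < r l /\
    (x 0 l != 0 -> 16 * e <= `|x 0 l|).
  near=> e; split; first by near: e; exact: nbhs_right_gt.
  near: e; apply: filter_forall => l.
  have [xl|xl] := eqVneq (x 0 l) 0; near=> e; (split; last first); rewrite ?xl//.

  - rewrite addrC -ltrBrDr mulrC -ltr_pdivlMr//.
    by near: e; apply: nbhs_right_lt; rewrite divr_gt0// subr_gt0 -xl.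
  - move=> _; rewrite mulrC -ler_pdivlMr//.
    by near: e; apply: nbhs_right_le; rewrite divr_gt0// normr_gt0.
  - rewrite addrC -ltrBrDr mulrC -ltr_pdivlMr//.
    by near: e; apply: nbhs_right_lt; rewrite divr_gt0// subr_gt0.
by have [e [e0 He]] := filter_ex H; exists e.
Unshelve. all: by end_near. Qed.

End derivative_facts.

(** * First-order expansion of the scalar field at the equilibrium *)

Section expansion.
Variables (R : realType) (m N : nat).
Hypothesis N_gt0 : (0 < N)%N.
Local Notation C := (real_complex R).
Variables (S : ordering m) (a : ('I_m -> nat) -> R) (f : 'rV[R]_m -> R).
Variable r : 'I_m -> R.
Hypothesis hf : taylor_expansion r f a.
Variables (x : 'rV[R]_m) (e : R).
Hypotheses (e_gt0 : 0 < e) (xr : forall l, `|x 0 l| + 2 * e < r l).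
Hypothesis xe : forall l, x 0 l != 0 -> 16 * e <= `|x 0 l|.
Hypothesis reg : mc_regular a x.

(** Contribution of the monomials of degree [k] to the termwise partial derivative of the Taylor
    series in the [p]-th variable at [x]. *)
Definition taylor_grad p k : R :=
  \sum_(J : {ffun 'I_m -> 'I_k.+1} | mdeg (mexp J) == k)
    a (mexp J) * dprod (fun l => x 0 l) (S (mexp J)) p.

Let prod_shift_le2 (s : seq 'I_m) :
  \prod_(p <- s) (`|x 0 p| + e) <= \prod_(p <- s) (`|x 0 p| + 2 * e).
Proof. by apply: prod_shift_le; have := e_gt0; lra. Qed.

Lemma taylor_grad_le p k : `|taylor_grad p k| <= e^-1 * taylor_major S a x e k.
Proof.
rewrite (le_trans (ler_norm_sum _ _ _))// mulr_sumr; apply: ler_sum => J _.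
rewrite normrM mulrCA ler_wpM2l// mulrC ler_pdivlMr//.
exact: le_trans (dprod_le _ _ _ (ltW e_gt0)) (prod_shift_le2 _).
Qed.

Lemma taylor_grad_cvg p : cvgn (series (fun k => taylor_grad p k.+1)).
Proof.
have MF := taylor_major_cvg (S := S) hf e_gt0 xr.
apply: (is_cvg_series_dominated (M := fun k => e^-1 * taylor_major S a x e k.+1)).
  by apply/cvg_ex; eexists; exact: cvg_seriesZ MF.
by move=> k; exact: taylor_grad_le.
Qed.

Section state.
Variables (X : 'M[R]_(m, N)) (t : R).
Hypotheses (t_ge0 : 0 <= t) (t_le1 : t <= 1).
Hypothesis Xx : forall p n, `|X p n - x 0 p| <= t * e.

Let h p := avg X p - x 0 p.

Lemma word_mean_mexp k (J : {ffun 'I_m -> 'I_k.+2}) : mdeg (mexp J) == k.+1 ->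
  a (mexp J) != 0 ->
  `|word_mean (S (mexp J)) X ^+ k.+1 - C (\prod_(p <- S (mexp J)) avg X p)| <=
  C (2 * t ^+ 2 * \prod_(p <- S (mexp J)) (`|x 0 p| + 2 * e)).
Proof.
move=> /eqP Jk aJ.
have sJ : size (S (mexp J)) = k.+1 by rewrite size_arrange.
have := @word_mean_near R 'I_m N N_gt0 (S (mexp J)) X (fun p => x 0 p) e t
  e_gt0 t_ge0 t_le1 Xx.
rewrite sJ; apply => // k1.
by rewrite count_arrange; apply: reg => //; rewrite Jk.
Qed.

Lemma mc_sum_Im_le k :
  `|complex.Im (mc_sum S a X k)| <= 3 * t ^+ 2 * taylor_major S a x e k.+1.
Proof.
rewrite /mc_sum Im_sum (le_trans (ler_norm_sum _ _ _))// mulr_sumr.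
apply: ler_sum => J Jk; rewrite Im_real_complexM normrM.
(* [mc_regular] constrains only multi-indices with nonzero coefficient; the others contribute 0. *)
have [->|aJ] := eqVneq (a (mexp J)) 0; first by rewrite normr0 !mul0r mulr0.
rewrite mulrCA ler_wpM2l//.
have := normr_complex_Im (word_mean_mexp Jk aJ).
rewrite raddfB/= subr0 => /le_trans; apply.
have P0 := shift_prod_ge0 x e_gt0 (S (mexp J)).
by have := mulr_ge0 (sqr_ge0 t) P0; lra.
Qed.

(** The constant 3 is 2 for replacing powers of [word_mean] by monomials in the averages, plus 1 for
    expanding these monomials to first order at [x]. *)
Lemma mc_sum_Re_le k :
  `|complex.Re (mc_sum S a X k) - taylor_sum a x k.+1 -
     \sum_p h p * taylor_grad p k.+1|
  <= 3 * t ^+ 2 * taylor_major S a x e k.+1.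
Proof.
rewrite /mc_sum Re_sum /taylor_sum -sumrB.
have -> : \sum_p h p * taylor_grad p k.+1 =
    \sum_(J : {ffun 'I_m -> 'I_k.+2} | mdeg (mexp J) == k.+1)
      a (mexp J) * \sum_p dprod (fun l => x 0 l) (S (mexp J)) p * h p.
  rewrite /taylor_grad; under eq_bigr do rewrite mulr_sumr.
  rewrite exchange_big/=; apply: eq_bigr => J _; rewrite mulr_sumr.
  by apply: eq_bigr => p _; ring.
rewrite -sumrB (le_trans (ler_norm_sum _ _ _))// mulr_sumr.
apply: ler_sum => J Jk; rewrite Re_real_complexM -!mulrBr normrM.
have [->|aJ] := eqVneq (a (mexp J)) 0; first by rewrite normr0 !mul0r mulr0.
rewrite mulrCA ler_wpM2l//.
have H1 := normr_complex_Re (word_mean_mexp Jk aJ).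
have H2 := @prod_seq_taylor1 R 'I_m (index_enum 'I_m) (fun l => x 0 l) h e t
  (S (mexp J)) (index_enum_uniq _) (fun q _ => mem_index_enum q)
  (ltW e_gt0) t_ge0 t_le1 (avg_near N_gt0 Xx).
have H3 := ler_wpM2l (sqr_ge0 t) (prod_shift_le2 (S (mexp J))).
move: H1 H2; rewrite raddfB/= -(monomialE S).
have -> : \prod_(p <- S (mexp J)) (x 0 p + h p) =
    \prod_(p <- S (mexp J)) avg X p.
  by apply: eq_bigr => p _; rewrite /h addrC subrK.
rewrite !ler_norml; lra.
Qed.

End state.

(** The degreewise estimates are summed against the majorant, so [b] and [F] are uniform in the
    state and in [t]. *)
Lemma mc_field_taylor : exists (b : 'I_m -> R) (F : R),
  forall (X : 'M[R]_(m, N)) t, 0 <= t -> t <= 1 ->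
  (forall p n, `|X p n - x 0 p| <= t * e) ->
  `|complex.Re (mc_field S a X) - f x - \sum_p (avg X p - x 0 p) * b p|
    <= 3 * t ^+ 2 * F /\
  `|complex.Im (mc_field S a X)| <= 3 * t ^+ 2 * F.
Proof.
exists (fun p => limn (series (fun k => taylor_grad p k.+1))).
exists (limn (series (fun k => taylor_major S a x e k.+1))) => X t t0 t1 Xx.
have MF := taylor_major_cvg (S := S) hf e_gt0 xr.
have [HR HI] := mc_field_cvg N_gt0 S hf e_gt0 xr t0 t1 Xx.
split; last exact: lim_series_dominated HI MF (mc_sum_Im_le t0 t1 Xx).
have xr' l : `|x 0 l| < r l by have := xr l; have := e_gt0; lra.
have HT := cvg_seriesZ (c := -1) (taylor_sum_cvg hf xr').
have HG : series (fun k => \sum_p (avg X p - x 0 p) * taylor_grad p k.+1) @ \oo -->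
    \sum_p (avg X p - x 0 p) * limn (series (fun k => taylor_grad p k.+1)).
  by apply: cvg_series_sum => p; apply: cvg_seriesZ; exact: taylor_grad_cvg.
have := cvg_seriesD (cvg_seriesD HR HT) (cvg_seriesZ (c := -1) HG).
have -> : complex.Re (mc_field S a X) - a (fun=> 0%N) + -1 * (f x - a (fun=> 0%N))
   = complex.Re (mc_field S a X) - f x by ring.
rewrite mulN1r => H; apply: lim_series_dominated H MF _ => k.
by have := mc_sum_Re_le t0 t1 Xx k; rewrite !mulN1r.
Qed.

Lemma mc_field_differentiable :
  differentiable (fun X : 'M[R]_(m, N) => complex.Re (mc_field S a X))
    (lift_state N x) /\
  differentiable (fun X : 'M[R]_(m, N) => complex.Im (mc_field S a X))
    (lift_state N x).
Proof.
have [b [F H]] := mc_field_taylor.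
have N0 : N%:R != 0 :> R by rewrite pnatr_eq0 -lt0n.
have He (h : 'M[R]_(m, N)) : `|h| <= e ->
   `|complex.Re (mc_field S a (lift_state N x + h)) - f x -
     \sum_p (avg (lift_state N x + h) p - x 0 p) * b p|
    <= 3 / e ^+ 2 * F * `|h| ^+ 2 /\
  `|complex.Im (mc_field S a (lift_state N x + h))| <= 3 / e ^+ 2 * F * `|h| ^+ 2.
  (* The expansion is used with [t] equal to the norm of [h] divided by [e]. *)
  move=> he; have -> : 3 / e ^+ 2 * F * `|h| ^+ 2 = 3 * (`|h| / e) ^+ 2 * F.
    by field; rewrite gt_eqF.
  apply: H; first by rewrite divr_ge0// ltW.
    by rewrite ler_pdivrMr// mul1r.
  move=> p n; rewrite !mxE [x 0 p + _]addrC addrK divfK ?gt_eqF//.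
  exact: normr_entry_le.
split; last first.
  by apply: (differentiable_quadratic (c := 3 / e ^+ 2 * F) e_gt0) => h /He[].
(* The real part is a quadratically small remainder plus an affine form in the entries of [X], in
   which every copy carries the weight [b p / N%:R]. *)
pose c (p : 'I_m) (n : 'I_N) := b p / N%:R.
rewrite (_ : (fun X => _) =
    ((fun X : 'M[R]_(m, N) => complex.Re (mc_field S a X) - f x -
       \sum_p (avg X p - x 0 p) * b p) +
    (cst (f x - \sum_p x 0 p * b p) +
     (fun X : 'M[R]_(m, N) => \sum_p \sum_n c p n * X p n)))); last first.
  apply/funext => X; rewrite !fctE.
  have -> : \sum_p (avg X p - x 0 p) * b p =
      \sum_p avg X p * b p - \sum_p x 0 p * b p.
    by rewrite -sumrB; apply: eq_bigr => p _; rewrite mulrBl.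
  have -> : \sum_p \sum_n c p n * X p n = \sum_p avg X p * b p.
    apply: eq_bigr => p _; rewrite -mulr_sumr /avg /c; ring.
  ring.
apply: differentiableD.
  by apply: (differentiable_quadratic (c := 3 / e ^+ 2 * F) e_gt0) => h /He[].
apply: differentiableD; first exact: differentiable_cst.
exact: differentiable_mx_form.
Qed.

End expansion.

(** * Derivatives of the scalar field by symmetry, and the Jacobian *)

Section jacobian.
Variables (R : realType) (m N : nat).
Hypothesis N_gt0 : (0 < N)%N.
Local Notation C := (real_complex R).
Variables (S : ordering m) (x : 'rV[R]_m).

Let D (a : ('I_m -> nat) -> R) (P : R[i] -> R) j l : R :=
  'D_(delta_mx j l) (fun X : 'M[R]_(m, N) => P (mc_field S a X)) (lift_state N x).

(** Exchanging the copies [l] and [l'] fixes the synchronised state, leaves the field invariant and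
    carries one direction to the other. *)
Lemma derive_mc_field_symmetric a (P : R[i] -> R) j l l' : D a P j l = D a P j l'.
Proof.
have E h : col_perm (tperm l l') (h *: delta_mx j l + lift_state N x) =
    h *: delta_mx j l' + lift_state N x.
  apply/matrixP => i n; rewrite !mxE.
  by rewrite (canF_eq (tpermK l l')) tpermL.
apply: derive_eq_line; near=> h.
by rewrite -E mc_field_col_perm.
Unshelve. all: by end_near. Qed.

(* The N equal derivatives add up to the derivative along the direction in
   which all the components of X_j move together. *)
Lemma derive_mc_field a (P : R[i] -> R) j l :
  differentiable (fun X : 'M[R]_(m, N) => P (mc_field S a X)) (lift_state N x) ->
  D a P j l = N%:R^-1 *
    'D_(delta_mx 0 j) (fun y : 'rV[R]_m => P (mc_field S a (lift_state N y))) x.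
Proof.
move=> df.
have E (h : R) : h *: (\sum_l' delta_mx j l') + lift_state N x =
    lift_state N (h *: delta_mx 0 j + x).
  apply/matrixP => i n; rewrite !mxE summxE (bigD1 n)//= !mxE eqxx andbT.
  rewrite big1 ?addr0// => q /negbTE nq.
  by rewrite mxE [n == q]eq_sym nq andbF.
have -> : 'D_(delta_mx 0 j) (fun y : 'rV[R]_m => P (mc_field S a (lift_state N y))) x
    = \sum_l' D a P j l'.
  transitivity ('D_(\sum_l' delta_mx j l') (fun X => P (mc_field S a X))
      (lift_state N x)).
    by apply: derive_eq_line; near=> h; rewrite E.
  (* Differentiability enters here: it makes the derivative additive in the direction. *)
  rewrite deriveE//.
  rewrite linear_sum.
  apply: eq_bigr => l' _.
  by rewrite /D deriveE.
rewrite (eq_bigr (fun=> D a P j l)); last first.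
  by move=> l' _; exact: derive_mc_field_symmetric.
rewrite sumr_const card_ord -[D a P j l *+ N]mulr_natl mulKf//.
 by rewrite pnatr_eq0 -lt0n.
Unshelve. all: by end_near. Qed.
(** The field restricts to [f] only over the polydisc, but a short enough segment of the line
    through [x] stays inside it. *)
Lemma derive_mc_field_lift a (f : 'rV[R]_m -> R) r (P : R[i] -> R) j :
  taylor_expansion r f a -> (forall l, `|x 0 l| < r l) ->
  'D_(delta_mx 0 j) (fun y : 'rV[R]_m => P (mc_field S a (lift_state N y))) x =
  'D_(delta_mx 0 j) (fun y : 'rV[R]_m => P (C (f y))) x.
Proof.
move=> hf xr; apply: derive_eq_line.
have [e e0 He] := polydisc_margin xr.
apply: filterS (nbhs0_le e0) => h he; rewrite !(mc_field_lift N_gt0 S hf)// => l.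
rewrite !mxE eqxx/= addrC (le_lt_trans (ler_normD _ _))//.
have [xe _] := He l; apply: le_lt_trans xe; rewrite lerD2l normrM.
apply: (@le_trans _ _ `|h|); last by lra.
by rewrite ler_piMr// ger0_norm ?ler0n// lern1 leq_b1.
Qed.

End jacobian.

Theorem proposition3p10 (R : realType) (m N : nat) (hN : (0 < N)%N)
    (f : 'I_m -> 'rV[R]_m -> R) (a : 'I_m -> ('I_m -> nat) -> R)
    (r : 'I_m -> R) (hf : forall i, taylor_expansion r (f i) (a i))
    (xs : 'rV[R]_m) (hxs : forall l, `|xs 0 l| < r l)
    (heq : forall i, f i xs = 0)
    (Q : 'I_m -> 'M[R]_N -> 'M[R]_N) (S : ordering m)
    (hQ : forall i, eligible S a (linear_decay Q) i) :
  forall i : 'I_m,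
    (mc_regular (a i) xs ->
       ext_differentiable S a (linear_decay Q) i (lift_state N xs)) /\
    (ext_differentiable S a (linear_decay Q) i (lift_state N xs) ->
       forall j : 'I_m,
         jacobian_block S a (linear_decay Q) (lift_state N xs) i j =
         embed ('D_(delta_mx 0 j) (f i) xs *: Omega1 R N +
                (i == j)%:R *: Q i (Omega1 R N))).
Proof.
move=> i.
pose q n (X : 'M[R]_(m, N)) : R := \sum_l Q i (Omega1 R N) n l * X i l.
have dq n : differentiable (q n) (lift_state N xs).
  rewrite (_ : q n = fun X : 'M[R]_(m, N) => \sum_p \sum_l
      ((p == i)%:R * Q i (Omega1 R N) n l) * X p l).
    exact: differentiable_mx_form.
  apply/funext => X; rewrite (bigD1 i)//= eqxx [X in _ = _ + X]big1 ?addr0.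
    by apply: eq_bigr => l _; rewrite mul1r.
  by move=> p /negbTE ->; apply: big1 => l _; rewrite !mul0r.
have qD n j l : 'D_(delta_mx j l) (q n) (lift_state N xs) =
    (i == j)%:R * Q i (Omega1 R N) n l.
  apply: derive_affine => h; rewrite /q.
  under eq_bigr do rewrite mxE mulrDr.
  rewrite big_split/= addrC; congr (_ + _).
  rewrite (bigD1 l)//= !mxE eqxx andbT big1 ?addr0.
    by rewrite mulrCA mulrC [RHS]mulrCA mulrC mulrA mulrAC; ring.
  by move=> l' /negbTE nl; rewrite !mxE nl andbF !mulr0.
pose g (X : 'M[R]_(m, N)) := mc_field S (a i) X.
have reE n : (fun X => complex.Re (ext_field S a (linear_decay Q) i X n 0)) =
    (fun X => complex.Re (g X)) + q n.
  by apply/funext => X; rewrite ext_fieldE// raddfD.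
have imE n : (fun X => complex.Im (ext_field S a (linear_decay Q) i X n 0)) =
    (fun X => complex.Im (g X)).
  by apply/funext => X; rewrite ext_fieldE// raddfD/= addr0.
split=> [reg n|hd j].
  have [e e0 He] := polydisc_margin hxs.
  have xr l : `|xs 0 l| + 2 * e < r l by have [] := He l.
  have xe l : xs 0 l != 0 -> 16 * e <= `|xs 0 l| by have [] := He l.
  have [dR dI] := mc_field_differentiable hN S (hf i) e0 xr xe reg.
  by rewrite /Cdifferentiable reE imE; split=> //; exact: differentiableD.
apply/matrixP => n l; have [] := hd n; rewrite reE imE => dR dI.
(* Subtracting the linear decay part gives the differentiability of the scalar field itself, as the
   symmetry argument requires. *)
have {}dR : differentiable (fun X => complex.Re (g X)) (lift_state N xs).
  rewrite -[X in differentiable X _](addrK (q n)).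
  exact: differentiableB dR (dq n).
rewrite !mxE /Cderive reE imE deriveD; try exact: diff_derivable.
rewrite qD !derive_mc_field// !(derive_mc_field_lift hN S _ _ (hf i) hxs)/=.
(* The imaginary part of [C (f i y)] is constantly 0, so the entry is real. *)
rewrite derive_cst mulr0 [_ * N%:R^-1]mulrC.
by [].
Qed.
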